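(* Let $(W,S)$ be an irreducible finite Coxeter group of rank $n\ge 2$ and let $m=\max\{m(s,t) : s,t\in S\}$. Let $X_{\mathrm{des}}$ be the number of $W$-descents of an element $w\in W$ chosen uniformly at random. Then \[ \mathbb{E}(X_{\mathrm{des}}) = n/2,\qquad \mathbb{V}(X_{\mathrm{des}}) = \frac{n-2}{12}+\frac1m. \]
   Context: $m(s,t)$ denotes the order of $st$ in $W$ (so $2m$ is the maximal size of a dihedral parabolic subgroup of $W$). Fix a root system $\Phi=\Phi^+\sqcup\Phi^-$ for $(W,S)$ with simple roots $\Delta$. For $w\in W$, $\mathrm{Des}(w)=\{\beta\in\Delta : w(\beta)\in\Phi^-\}$ and $\mathrm{des}(w)=\#\mathrm{Des}(w)$. *)

(* Defs.v *)
From mathcomp Require Import all_boot all_order all_algebra all_fingroup.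
From mathcomp Require Import all_classical all_reals.
From mathcomp Require Import trigo.
Set Implicit Arguments. Unset Strict Implicit. Unset Printing Implicit Defensive.
Import Order.TTheory GRing.Theory Num.Theory.
Local Open Scope ring_scope.

(* A Coxeter system (W, S) inside a finite group gT, with S = {s i | i < n}
   (so rank n = |S|, s injective).  m(s i, s j) = #[s i * s j]. *)

(* Universal property of the Coxeter presentation, quantified over every group
   (given as a carrier type with its operations and axioms). *)
Definition coxeter_presentation (gT : finGroupType) (W : {set gT}) (n : nat)
    (s : 'I_n -> gT) : Prop :=
  forall (H : Type) (mul : H -> H -> H) (one : H) (inv : H -> H),
    associative mul -> left_id one mul -> left_inverse one inv mul ->
    forall f : 'I_n -> H,
      (forall i, mul (f i) (f i) = one) ->
      (forall i j, iter #[s i * s j]%g (mul (mul (f i) (f j))) one = one) ->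
      exists phi : gT -> H,
        (forall i, phi (s i) = f i) /\
        {in W &, forall x y, phi (x * y)%g = mul (phi x) (phi y)}.

Definition coxeter_system (gT : finGroupType) (W : {group gT}) (n : nat)
    (s : 'I_n -> gT) : Prop :=
  [/\ injective s,
      (forall i, s i != 1%g /\ (s i ^+ 2 = 1)%g),
      W :=: <<[set s i | i : 'I_n]>>%g
    & coxeter_presentation W s].

(* Irreducible: S cannot be split into two nonempty mutually commuting parts
   (equivalently, the Coxeter graph is connected). *)
Definition coxeter_irreducible (gT : finGroupType) (n : nat) (s : 'I_n -> gT) : Prop :=
  forall A : {set 'I_n},
    (forall i j, i \in A -> j \notin A -> (s i * s j = s j * s i)%g) ->
    A = finset.set0 \/ A = [set: 'I_n].

Definition coxeter_max_m (gT : finGroupType) (n : nat) (s : 'I_n -> gT) : nat :=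
  \max_(i < n) \max_(j < n) #[s i * s j]%g.

(* Geometric (Tits) representation: basis of simple roots alpha_i (the
   standard basis of R^n as column vectors), B(alpha_i, alpha_j) = -cos(pi/m_ij). *)
Definition coxB (R : realType) (gT : finGroupType) (n : nat) (s : 'I_n -> gT)
    (i j : 'I_n) : R :=
  - cos (pi / (#[s i * s j]%g)%:R).

(* sigma_i (v) = v - 2 B(alpha_i, v) alpha_i, as a matrix acting on columns. *)
Definition coxsigma (R : realType) (gT : finGroupType) (n : nat) (s : 'I_n -> gT)
    (i : 'I_n) : 'M[R]_n :=
  \matrix_(k, l) ((k == l)%:R - 2 * (k == i)%:R * coxB R s i l).

Definition geometric_rep (R : realType) (gT : finGroupType) (W : {set gT}) (n : nat)
    (s : 'I_n -> gT) (rho : gT -> 'M[R]_n) : Prop :=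
  (forall i, rho (s i) = coxsigma R s i) /\
  {in W &, forall x y, rho (x * y)%g = rho x *m rho y}.

(* Des(w) = simple roots alpha_j with w(alpha_j) in Phi^-, i.e. all coordinates of
   w(alpha_j) = column j of rho w (in the basis of simple roots) are <= 0. *)
Definition Des (R : realType) (gT : finGroupType) (n : nat) (rho : gT -> 'M[R]_n)
    (w : gT) : {set 'I_n} :=
  [set j : 'I_n | [forall k : 'I_n, rho w k j <= 0]].

Definition des (R : realType) (gT : finGroupType) (n : nat) (rho : gT -> 'M[R]_n)
    (w : gT) : nat := #|Des rho w|.

Definition unif_mean (R : realType) (gT : finGroupType) (W : {set gT})
    (X : gT -> nat) : R :=
  (\sum_(w in W) (X w)%:R) / #|W|%:R.

Definition unif_var (R : realType) (gT : finGroupType) (W : {set gT})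
    (X : gT -> nat) : R :=
  (\sum_(w in W) ((X w)%:R - unif_mean R W X) ^+ 2) / #|W|%:R.

Arguments geometric_rep {R gT} W {n} s rho.
Arguments unif_mean R {gT} W X.
Arguments unif_var R {gT} W X.
Arguments des {R gT n} rho w.
Arguments Des {R gT n} rho w.

(* Main.v *)
(* The number of descents is a sum of indicators, so its first two moments are
   determined by the probabilities that s_i, or both s_i and s_j, are descents.
   By Tits' theorem every w(alpha_i) is positive or negative according as
   l(w s_i) >= l(w) or not; hence right multiplication by s_i toggles the
   descent i, and each coset of the dihedral group <s_i, s_j> contains exactly
   one element with both descents, its longest one.  So the second moment is the
   sum over all i, j of 1 / (2 m_ij).

   As W is finite, averaging gives an invariant inner product, and irreducibility
   makes it proportional to the Tits form, which is therefore positive definite.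
   Growing the Coxeter graph vertex by vertex from an edge of maximal label m,
   positivity forces every new vertex to be attached by a single edge of label 3.
   So the graph is a tree with n - 2 edges of label 3 and one of label m, which
   evaluates the sum. *)

Require Import Defs.
From mathcomp Require Import all_boot all_order all_algebra all_fingroup.
From mathcomp Require Import all_classical all_reals.
From mathcomp Require Import trigo.
From mathcomp Require Import cyclic zify ring lra.
Import Order.TTheory GRing.Theory Num.Theory.
Local Open Scope ring_scope.

(** * Alternating words in two involutions *)

Section AlternatingWords.
Context {gT : finGroupType}.
Local Open Scope group_scope.
Implicit Types a b : gT.

(** The last letter is [a]: words grow on the right because descents concern right
    multiplication. *)
Fixpoint alt a b k : gT := if k is k'.+1 then alt b a k' * a else 1.

Lemma alt_double a b k : alt a b k.*2 = (b * a) ^+ k.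
Proof. by elim: k => [|k IHk] //=; rewrite IHk expgSr mulgA. Qed.

(** The braid relation: for either parity, moving everything to one side reduces it to
    [(a * b) ^+ m = 1], with [m] the order of [a * b]. *)
Lemma alt_braid a b : a ^+ 2 = 1 -> b ^+ 2 = 1 ->
  alt a b #[a * b] = alt b a #[a * b].
Proof.
move=> a2 b2.
have aV : a^-1 = a by apply/eqP; rewrite eq_invg_mul -expg2 a2.
have bV : b^-1 = b by apply/eqP; rewrite eq_invg_mul -expg2 b2.
have baV : (a * b)^-1 = b * a by rewrite invMg aV bV.
have := odd_double_half #[a * b]; have := expg_order (a * b).
move: #[_] => m; move: (m./2) => k; case: (odd m) => /= abm mE.
  rewrite -mE add1n /= !alt_double.
  rewrite -baV expgVn.
  have -> : (a * b) ^- k * b = (b * (a * b) ^+ k)^-1 by rewrite invMg bV.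
  apply/invg_inj; rewrite invgK.
  apply/eqP; rewrite eq_invg_mul !mulgA -(mulgA _ a) -expgSr -expgD -abm -mE.
  by rewrite addSn addnn add1n.
rewrite -mE add0n !alt_double -baV expgVn; apply/eqP.
by rewrite eq_invg_mul -expgD addnn -[k.*2]add0n mE abm.
Qed.

Lemma alt_comm a b v j : a ^+ 2 = 1 -> (0 < j)%N -> v * alt a b j * a = v * alt b a j.-1.
Proof. by case: j => // j a2 _; rewrite /= -!mulgA -expg2 a2 mulg1. Qed.

End AlternatingWords.

Section DihedralSubgroup.

(** * The dihedral subgroup of two involutions *)

Context {gT : finGroupType}.
Local Open Scope group_scope.
Implicit Types a b x : gT.

Lemma commute_order2 a b : a ^+ 2 = 1 -> b ^+ 2 = 1 -> #[a * b] = 2%N -> a * b = b * a.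
Proof.
move=> a2 b2 ab; apply/eqP; have := expg_order (a * b); rewrite ab expg2.
move/eqP; rewrite -eq_invg_mul invMg => /eqP <-; apply/eqP.
by congr (_ * _); apply/eqP; rewrite eq_invg_mul -expg2 ?a2 ?b2.
Qed.

(** For involutions, [b] inverts the rotation [a * b], so this join is a product of two cyclic
    subgroups and its order can be read off. *)
Definition dihedral a b : {group gT} := (<[a * b]> <*> <[b]>)%G.

Lemma dihedralE a b : a ^+ 2 = 1 -> b ^+ 2 = 1 ->
  dihedral a b = <[a * b]> * <[b]> :> {set gT}.
Proof.
move=> a2 b2; rewrite /= norm_joinEr // norms_cycle.
have -> : (a * b) ^ b = (a * b)^-1; last by rewrite groupV cycle_id.
rewrite conjgE invMg -(mulgA a) -expg2 b2 mulg1; congr (_ * _).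
by apply/eqP; rewrite eq_sym eq_invg_mul -expg2 a2.
Qed.

Lemma card_dihedral a b : a ^+ 2 = 1 -> b ^+ 2 = 1 -> a != 1 -> b != 1 ->
  #|dihedral a b| = (2 * #[a * b])%N.
Proof.
move=> a2 b2 a1 b1; rewrite dihedralE //.
have ob : #[b] = 2 by apply: nt_prime_order.
(* If [b] were a power of [a * b], it would commute with [a], so [a * b] would have order at most 2,
   forcing [b = 1] or [a = 1]. *)
have nb : b \notin <[a * b]>.
  apply/negP => /cyclePmin[k kab bE].
  have cab : a * b = b * a.
    have /commute_sym : commute (a * b) b by rewrite {2}bE; apply: commuteX.
    by rewrite /commute mulgA => /mulIg ->.
  have ab2 : (#[a * b] %| 2)%N by rewrite order_dvdn expgMn // a2 b2 mulg1.
  have := dvdn_leq (ltn0Sn 1) ab2; case: k kab bE => [|[|k]] kab bE.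
  - by rewrite bE eqxx in b1.
  - move=> _; case/eqP: a1; apply: (mulIg b).
    by rewrite mul1g [RHS]bE.
  - by rewrite leqNgt (leq_ltn_trans _ kab).
rewrite TI_cardMg; first by rewrite /order mulnC -!/(order _) ob.
by rewrite finset.setIC prime_TIg ?cycle_subG // -orderE ob.
Qed.

Lemma dihedral_gen a b : a \in dihedral a b /\ b \in dihedral a b.
Proof.
have bG : b \in dihedral a b by rewrite mem_gen // inE cycle_id orbT.
split=> //; rewrite -(groupMr _ bG).
by rewrite mem_gen // inE cycle_id.
Qed.

Lemma mem_alt_group (G : {group gT}) a b k : a \in G -> b \in G -> alt a b k \in G.
Proof. by elim: k a b => //= k IHk a b aG bG; rewrite groupM ?IHk. Qed.

Lemma mem_dihedral a b x : a ^+ 2 = 1 -> b ^+ 2 = 1 -> x \in dihedral a b ->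
  exists2 j, (j <= #[a * b])%N & x = alt a b j \/ x = alt b a j.
Proof.
move=> a2 b2; pose P x := exists2 j, (j <= #[a * b])%N & x = alt a b j \/ x = alt b a j.
have br := alt_braid a b a2 b2.
(* Multiplying by [c] cancels a last letter [c] and otherwise lengthens the word; at full length the
   braid relation first makes it end in [c]. *)
have stepA (c d y : gT) : [/\ c ^+ 2 = 1, alt c d #[a * b] = alt d c #[a * b] &
    exists2 j, (j <= #[a * b])%N & y = alt c d j \/ y = alt d c j] ->
    exists2 j, (j <= #[a * b])%N & y * c = alt c d j \/ y * c = alt d c j.
  move=> [c2 cd [j jm]].
  have red i : (0 < i)%N -> alt c d i * c = alt d c i.-1.
    by move=> i0; rewrite -[alt c d i]mul1g alt_comm // mul1g.
  have m0 : (0 < #[a * b])%N by [].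
  case=> ->.
    case: (posnP j) => [->|j0]; last by exists j.-1; [lia|right; rewrite red].
    by exists 1%N; [|left].
  case: (ltngtP j #[a * b]) => [jm'|jm'|->]; [|lia|].
    by exists j.+1; [|left].
  by exists #[a * b].-1; [lia|right; rewrite -cd red].
have Pa y : P y -> P (y * a) by move=> Py; apply: stepA.
have Pb y : P y -> P (y * b).
  move=> [j jm yE]; have [|k km kE] := stepA b a y; last by exists k => //; apply/or_comm.
  by split=> //; exists j => //; apply/or_comm.
have P1 : P 1 by exists 0%N; [|left].
rewrite dihedralE // => /mulsgP[y z /cycleP[k ->] /cycleP[l ->] ->].
elim: l => [|l IHl]; last by rewrite expgSr mulgA; apply: Pb.
rewrite mulg1; elim: k => [|k IHk] //; rewrite expgSr mulgA.
exact/Pb/Pa.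
Qed.

End DihedralSubgroup.

(** * Positive definite Coxeter graphs *)

Section CosineBounds.
Context (R : realType).

Lemma cos_pi_div_le p r : (0 < p)%N -> (p <= r)%N ->
  cos (pi / p%:R) <= cos (pi / r%:R) :> R.
Proof.
move=> p0 pr; have r0 := leq_trans p0 pr.
have itv k : (0 < k)%N -> pi / k%:R \in `[0, pi : R].
  move=> k0; rewrite in_itv /= divr_ge0 ?pi_ge0 ?ler0n //=.
  by rewrite ler_pdivrMr ?ltr0n // ler_peMr ?pi_ge0 // ler1n.
rewrite leNgt ltr_cos ?itv // -leNgt.
by rewrite ler_pM2l ?pi_gt0 // lef_pV2 ?posrE ?ltr0n // ler_nat.
Qed.

Lemma cos_pi_div2_gt0 p : (2 < p)%N -> 0 < cos (pi / p%:R) :> R.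
Proof.
move=> p2; have p0 : (0 < p)%N by lia.
apply: cos_gt0_pihalf; rewrite (@lt_trans _ _ 0) ?oppr_lt0 ?divr_gt0 ?pi_gt0 ?ltr0n //=.
by rewrite ltr_pM2l ?pi_gt0 // ltf_pV2 ?posrE ?ltr0n ?ltr_nat //; lia.
Qed.

(** By the triple angle formula [c] is a root of 4 c^3 - 3 c + 1 = (c + 1) (2 c - 1)^2, and
    [c > 0]. *)
Lemma cos_pi_div3 : cos (pi / 3) = 1 / 2 :> R.
Proof.
have c0 := cos_pi_div2_gt0 3 isT; set c := cos _ in c0 *.
have : cos (pi / 3 *+ 2 + pi / 3) = -1 :> R.
  by rewrite -[RHS]cospi; congr cos; field.
rewrite cosD cos_mulr2n sin_mulr2n -/c => h.
have : (c + 1) * (2 * c - 1) ^+ 2 = 0.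
  have s2 := sin2cos2 (pi / 3 : R); rewrite -/c in s2.
  have {}h : (c ^+ 2 *+ 2 - 1) * c - c * sin (pi / 3) ^+ 2 *+ 2 = -1 by apply: etrans h; ring.
  by rewrite s2 in h; nra.
move/eqP; rewrite mulf_eq0 sqrf_eq0 => /orP[] /eqP; lra.
Qed.

Lemma cos_pi_div4_sqr : cos (pi / 4) ^+ 2 = 1 / 2 :> R.
Proof.
have : cos (pi / 4 *+ 2) = 0 :> R.
  by rewrite -[RHS]cos_pihalf; congr cos; field.
rewrite cos_mulr2n; lra.
Qed.

End CosineBounds.

Section CoxeterGraph.
Context (R : realType) (n : nat) (m : 'I_n -> 'I_n -> nat).
Local Notation B i j := (- cos (pi / (m i j)%:R) : R).
Hypothesis m_diag : forall i, m i i = 1%N.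
Hypothesis m_sym : forall i j, m i j = m j i.
Hypothesis m_ge2 : forall i j, i != j -> (2 <= m i j)%N.
Hypothesis m_irr : forall A : {set 'I_n},
  (forall i j, i \in A -> j \notin A -> m i j = 2%N) -> A = finset.set0 \/ A = [set: 'I_n].

Definition cox_form (y : 'I_n -> R) : R := \sum_i \sum_j y i * y j * B i j.
Hypothesis form_gt0 : forall y, (exists i, y i != 0) -> 0 < cox_form y.

Lemma B_le0 i j : i != j -> B i j <= 0.
Proof.
by move=> /m_ge2 mij; rewrite oppr_le0 -(@cos_pihalf R) cos_pi_div_le.
Qed.

Lemma B_edge i j : (3 <= m i j)%N -> B i j <= - (1 / 2).
Proof. by move=> mij; rewrite lerN2 -cos_pi_div3 cos_pi_div_le. Qed.

(** Test vectors are built one coordinate at a time; the last coefficient is 1 because [B j j] is -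
    cos pi. *)
Lemma cox_form_add y j (w : R) :
  cox_form (fun i => y i + w * (i == j)%:R) =
  cox_form y + 2 * w * (\sum_i y i * B i j) + w ^+ 2.
Proof.
rewrite /cox_form.
have delta (f : 'I_n -> R) : \sum_i (i == j)%:R * f i = f j.
  rewrite (bigD1 j) //= eqxx mul1r big1 ?addr0 // => i /negPf->.
  by rewrite mul0r.
transitivity (\sum_i (\sum_k y i * y k * B i k + w * (y i * B i j)
    + (i == j)%:R * (w * (\sum_k y k * B i k) + w ^+ 2 * B i j))).
  apply: eq_bigr => i _; rewrite -(delta (fun k => y i * B i k)) -(delta (fun k => B i k)).
  rewrite !mulr_sumr -!big_split /= mulr_sumr -!big_split /=.
  by apply: eq_bigr => k _; ring.
rewrite !big_split /= delta -mulr_sumr m_diag divr1 cospi opprK.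
have -> : \sum_k y k * B j k = \sum_k y k * B k j by apply: eq_bigr => k _; rewrite m_sym.
ring.
Qed.

(* [c] makes the form at most [c ^+ 2] on [1_a + c 1_b] for an edge [ab] of
   maximal label: [c = 1] if that label is 3 and [c = 1 / sqrt 2] otherwise. *)
Variable c : R.
Hypothesis c_gt0 : 0 < c.
Hypothesis c_le1 : c <= 1.
Hypothesis c_heavy : forall i j, (4 <= m i j)%N -> c <= cos (pi / (m i j)%:R).

(** As constructed below, [y] is 1 on one side of the initial edge and [c] on the other, and [z] is
    the reverse. Whichever vertex a new one is attached to, one of the two vectors is 1 there. *)
Definition tree_weights (A : {set 'I_n}) (y z : 'I_n -> R) : Prop :=
  [/\ forall i, i \notin A -> y i = 0 /\ z i = 0,
      forall i, i \in A -> (y i = 1 /\ z i = c) \/ (y i = c /\ z i = 1),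
      cox_form y <= c ^+ 2 & cox_form z <= c ^+ 2].

Lemma tree_weightsC A y z : tree_weights A y z -> tree_weights A z y.
Proof.
move=> [y0 yA qy qz]; split=> // i; first by move/y0 => [].
by move=> /yA[] []; [right|left].
Qed.

(* A new vertex is attached to the tree by exactly one edge, of label 3:
   otherwise [1_j] could be added with weight 1 or [c] so as to make the form
   nonpositive. *)
Lemma tree_weights_extend A y z i j : tree_weights A y z -> i \in A -> j \notin A ->
  y i = 1 -> z i = c -> (3 <= m i j)%N ->
  [/\ m i j = 3%N, forall l, l \in A -> l != i -> m l j = 2%N &
   exists y' z', tree_weights (j |: A) y' z'].
Proof.
move=> [y0 yA qy qz] iA jA yi zi mij; have [c0 c1] := (c_gt0, c_le1).
have neqj l : l \in A -> l != j by apply: contraTneq => ->.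
(* All terms are nonpositive, so keeping only one or two neighbours of [j] bounds the sum from
   above. *)
have sum_le (x : 'I_n -> R) :
    (forall l, l \notin A -> x l = 0) -> (forall l, l \in A -> 0 <= x l) ->
    forall P : pred 'I_n, (forall l, P l -> l \in A) ->
    \sum_l x l * B l j <= \sum_(l | P l) x l * B l j.
  move=> x0 xA P PA; rewrite [leRHS]big_mkcond; apply: ler_sum => l _; case: ifP => // Pl.
  have [lA|/x0->] := boolP (l \in A); last by rewrite mul0r.
  by rewrite mulr_ge0_le0 ?xA // B_le0 // neqj.
have y_ge0 l : l \in A -> 0 <= y l by move=> /yA[] [-> _]; lra.
have z_ge0 l : l \in A -> 0 <= z l by move=> /yA[] [_ ->]; lra.
have ysum := sum_le y (fun l lA => (y0 l lA).1) y_ge0.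
have zsum := sum_le z (fun l lA => (y0 l lA).2) z_ge0.
have pos (w : R) : 0 < cox_form (fun l => y l + w * (l == j)%:R).
  apply: form_gt0; exists i; rewrite (negPf (neqj i iA)) mulr0 addr0 yi.
  exact: oner_neq0.
have Bij := B_edge i j mij.
have pred1A l : pred1 i l -> l \in A by move=> /eqP->.
have ysum1 := ysum _ pred1A; have zsum1 := zsum _ pred1A.
rewrite !big_pred1_eq yi zi in ysum1 zsum1.
(* A label at least 4 gives [B i j <= - c]; weight [c] at [j] then makes the form at most c^2 - 2
   c^2 + c^2 = 0. *)
have mij3 : m i j = 3%N.
  apply/eqP; rewrite eqn_leq mij andbT leqNgt; apply/negP => mij4.
  have := c_heavy i j mij4; have := pos c; rewrite cox_form_add; nra.
(* With a second neighbour [l], weight 1 at [j] makes the form at most c^2 - (1 + c) + 1 = c^2 - c,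
   which is nonpositive. *)
have mlj l : l \in A -> l != i -> m l j = 2%N.
  move=> lA li; apply/eqP; rewrite eqn_leq m_ge2 ?neqj // andbT leqNgt.
  apply/negP => mlj; have Blj := B_edge l j mlj.
  have pred2A k : k \in i |: finset.set1 l -> k \in A by rewrite !inE => /orP[] /eqP->.
  have := ysum _ pred2A; rewrite big_setU1 ?inE 1?eq_sym //= big_set1 => ysum2.
  have yl : c <= y l by case: (yA l lA) => -[-> _]; lra.
  have := pos 1; rewrite cox_form_add; nra.
(* The vertex [j] copies the weight [w] of [i]: across an edge of label 3 this changes the form by
   at most - w^2 + w^2 = 0. *)
split=> //; exists (fun l => y l + 1 * (l == j)%:R), (fun l => z l + c * (l == j)%:R).
split=> [l|l||].
- by rewrite in_setU1 negb_or => /andP[/negPf-> /y0[-> ->]]; rewrite !mulr0 !addr0.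
- rewrite in_setU1 => /predU1P[->|lA].
    by rewrite eqxx; have [-> ->] := y0 j jA; left; rewrite !mulr1 !add0r.
  by rewrite (negPf (neqj l lA)) !mulr0 !addr0; apply: yA.
- rewrite cox_form_add; nra.
- rewrite cox_form_add; nra.
Qed.

Definition inv_sum (A : {set 'I_n}) : R := \sum_(i in A) \sum_(j in A) (m i j)%:R^-1.

Lemma inv_sumU1 (A : {set 'I_n}) j : j \notin A ->
  inv_sum (j |: A) = inv_sum A + 1 + 2 * \sum_(l in A) (m l j)%:R^-1.
Proof.
move=> jA; rewrite /inv_sum big_setU1 //= big_setU1 //= m_diag invr1.
under [X in _ + X]eq_bigr do rewrite big_setU1 //=.
rewrite big_split /= [X in 1 + X](eq_bigr (fun l => (m l j)%:R^-1)); first ring.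
by move=> l _; rewrite m_sym.
Qed.

(** Irreducibility gives an edge leaving [A]. The new vertex adds 1 on the diagonal and, twice, 1/3
    for its edge and 1/2 for each of the other [#|A| - 1] vertices. *)
Lemma tree_extend A y z : tree_weights A y z -> A != finset.set0 -> A != [set: 'I_n] ->
  exists j, [/\ j \notin A, exists y' z', tree_weights (j |: A) y' z' &
    inv_sum (j |: A) = inv_sum A + #|A|%:R + 2 / 3].
Proof.
move=> yzA A0 AT.
have [i [j [iA jA mij]]] : exists i j, [/\ i \in A, j \notin A & m i j != 2%N].
  apply: contrapT => h; have [] : A = finset.set0 \/ A = [set: 'I_n].
  - apply: m_irr => i j iA jA; apply/eqP; apply: contrapT => /negP mij.
    by apply: h; exists i, j.
  - by move/eqP; rewrite (negPf A0).
  - by move/eqP; rewrite (negPf AT).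
have ij : i != j by apply: contraNneq jA => <-.
have {}mij : (3 <= m i j)%N by rewrite ltn_neqAle eq_sym mij m_ge2.
have [mij3 mlj yzA'] : [/\ m i j = 3%N, forall l, l \in A -> l != i -> m l j = 2%N &
   exists y' z', tree_weights (j |: A) y' z'].
  have [_ yA _ _] := yzA; case: (yA i iA) => -[yi zi].
    exact: (tree_weights_extend A y z i j yzA iA) jA yi zi mij.
  exact: (tree_weights_extend A z y i j (tree_weightsC A y z yzA) iA) jA zi yi mij.
exists j; split=> //; rewrite inv_sumU1 // (bigD1 i) //= mij3.
rewrite (eq_bigr (fun=> 2^-1)); last by move=> l /andP[lA li]; rewrite mlj.
have -> : \sum_(l in A | l != i) 2^-1 = (#|A|%:R - 1) / 2 :> R.
  have -> : #|A|%:R = #|[predD1 A & i]|%:R + 1 :> R by rewrite natr1 (cardD1 i) iA.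
  rewrite sumr_const addrK mulr_natl; congr (_ *+ _).
  by apply: eq_card => l; rewrite !inE andbC.
lra.
Qed.

(* For a tree on [k] vertices with one edge labelled [mu] and all others labelled 3:
   [k] diagonal terms 1, [k^2 - 3k + 2] non-edges 1/2, [2 (k - 2)] terms 1/3 and
   two terms [1 / mu]. *)
Definition tree_inv_sum (k mu : R) : R :=
  k + (k ^+ 2 - 3 * k + 2) / 2 + 2 * (k - 2) / 3 + 2 / mu.

(** The condition on [c] says that 1 + c^2 - 2 c cos(pi / m a b), the form on the initial edge, is
    at most c^2. This starts the growth of the tree up to all [n] vertices. *)
Lemma inv_sumT a b : a != b -> 1 <= 2 * c * cos (pi / (m a b)%:R) ->
  inv_sum [set: 'I_n] = tree_inv_sum n%:R (m a b)%:R.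
Proof.
move=> ab cab; have [c0 c1] := (c_gt0, c_le1).
have grow k : (2 <= k <= n)%N -> exists A : {set 'I_n}, [/\ #|A| = k,
    exists y z, tree_weights A y z & inv_sum A = tree_inv_sum k%:R (m a b)%:R].
  elim: k => // k IHk; rewrite leq_eqVlt => /andP[/predU1P[<- _|k2 kn]].
    exists (a |: finset.set1 b); split.
    - by rewrite cards2 ab.
    - have form1 : cox_form (fun=> 0) = 0.
        by rewrite /cox_form big1 // => i _; rewrite big1 // => j _; rewrite !mul0r.
      have form2 u v i j : i != j -> cox_form (fun l => u * (l == i)%:R + v * (l == j)%:R) =
          u ^+ 2 + v ^+ 2 - 2 * u * v * cos (pi / (m i j)%:R).
        move=> ij; rewrite cox_form_add.
        have -> : cox_form (fun l => u * (l == i)%:R) = u ^+ 2.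
          transitivity (cox_form (fun l => 0 + u * (l == i)%:R)).
            by congr cox_form; apply/funext => l; rewrite add0r.
          by rewrite cox_form_add form1 big1 ?mulr0 ?add0r // => l _; rewrite mul0r.
        rewrite (bigD1 i) //= eqxx mulr1 big1 ?addr0; first by ring.
        by move=> l /negPf->; rewrite mulr0 mul0r.
      exists (fun l => 1 * (l == a)%:R + c * (l == b)%:R).
      exists (fun l => c * (l == a)%:R + 1 * (l == b)%:R); split=> [l|l||].
      + by rewrite !inE negb_or => /andP[/negPf-> /negPf->]; rewrite !mulr0 !addr0.
      + rewrite !inE => /orP[] /eqP->; rewrite eqxx ?(negPf ab) 1?eq_sym ?(negPf ab) /=.
          by left; split; ring.
        by right; split; ring.
      + by rewrite form2 //; lra.
      + by rewrite form2 //; lra.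
    - rewrite inv_sumU1 ?inE // big_set1 /inv_sum !big_set1 m_diag (m_sym b a) /tree_inv_sum.
      by field; rewrite pnatr_eq0 -lt0n (leq_trans _ (m_ge2 _ _ ab)).
  have [A [Ak [y [z yzA]] sumA]] := IHk (introT andP (conj k2 (ltnW kn))).
  have [||j [jA yzA' sumA']] := tree_extend A y z yzA.
  - by rewrite -card_gt0 Ak; lia.
  - by apply: contraTneq kn => AT; rewrite -leqNgt -Ak AT cardsT card_ord.
  exists (j |: A); split=> //; first by rewrite cardsU1 jA Ak.
  rewrite sumA' sumA Ak /tree_inv_sum -natr1; field.
  by rewrite pnatr_eq0 -lt0n (leq_trans _ (m_ge2 _ _ ab)).
have n2 : (2 <= n)%N.
  by rewrite -[n in leqRHS]card_ord (cardD1 a) (cardD1 b) !inE eq_sym ab.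
have [|A [An _ <-]] := grow n; first by rewrite n2 leqnn.
congr inv_sum; apply/eqP; rewrite eq_sym eqEcard finset.subsetT cardsT card_ord An.
exact: leqnn.
Qed.

End CoxeterGraph.

(** * Word length and dihedral cosets *)

Section Length.
Context {gT : finGroupType} (W : {group gT}) (n : nat) (s : 'I_n -> gT).
Local Open Scope group_scope.
Local Open Scope nat_scope.
Local Notation "x * y" := (mulg x y).
Hypothesis s2 : forall i, s i ^+ 2 = 1%g.
Hypothesis defW : W :=: <<[set s i | i : 'I_n]>>.

(* The proof needs only these properties of the word length. *)
Definition length_like (len : gT -> nat) : Prop :=
  [/\ forall w, w \in W -> len w = 0 -> w = 1%g,
      forall w i, w \in W -> len (w * s i) <= (len w).+1
    & forall w, w \in W -> 0 < len w -> exists i, len (w * s i) < len w].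

Lemma mem_gen_refl i : s i \in W.
Proof. by rewrite defW mem_gen // imset_f. Qed.

Lemma mulgK_refl (w : gT) i : w * s i * s i = w.
Proof. by rewrite -mulgA -expg2 s2 mulg1. Qed.

Lemma length_like_exists : exists len, length_like len.
Proof.
pose P w k := exists2 q : seq 'I_n, size q = k & (\prod_(i <- q) s i)%g = w.
have exP w : exists k, w \in W -> P w k /\ forall j, P w j -> k <= j.
  case: (boolP (w \in W)) => [Ww|_]; last by exists 0.
  have exk : exists k, `[< P w k >].
    move: Ww; rewrite defW => /gen_prodgP[k [c cs ->]].
    exists k; apply/asboolP.
    have cP i : exists j, c i = s j by have /imsetP[j _ ->] := cs i; exists j.
    have [f fE] := choice cP; exists [seq f i | i <- index_enum 'I_k].
      by rewrite size_map /index_enum -enumT size_enum_ord.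
    by rewrite big_map; apply: eq_bigr => i _; rewrite fE.
  by case: (ex_minnP exk) => k /asboolP Pk kmin; exists k => _; split=> // j /asboolP/kmin.
have [len lenP] := choice exP; exists len.
split=> [w Ww len0|w i Ww|w Ww len_gt0].
- by have [[q] ] := lenP w Ww; rewrite len0 => /size0nil-> <-; rewrite big_nil.
- have [[q <- qw] _] := lenP w Ww.
  have [_ ] := lenP (w * s i) (groupM Ww (mem_gen_refl i)); apply.
  by exists (rcons q i); rewrite ?size_rcons // big_rcons /= qw.
- have [[q]] := lenP w Ww; case/lastP: q => [|q i]; first by move=> l0; rewrite -l0 in len_gt0.
  rewrite size_rcons big_rcons /= => qi qw _; exists i; rewrite -qi ltnS.
  have [_ ] := lenP (w * s i) (groupM Ww (mem_gen_refl i)); apply.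
  by exists q => //; rewrite -qw mulgK_refl.
Qed.

Variable len : gT -> nat.
Hypothesis lenP : length_like len.

Lemma length_mul w i : w \in W -> len (w * s i) <= (len w).+1.
Proof. by case: lenP => _ + _; apply. Qed.

Lemma length_mulV w i : w \in W -> len w <= (len (w * s i)).+1.
Proof.
by move=> Ww; rewrite -{1}(mulgK_refl w i) length_mul // groupM ?mem_gen_refl.
Qed.

Lemma mem_alt i j k : alt (s i) (s j) k \in W.
Proof. by rewrite mem_alt_group ?mem_gen_refl. Qed.

Lemma length_alt v i j k : v \in W -> len (v * alt (s i) (s j) k) <= len v + k.
Proof.
move=> Wv; elim: k i j => [|k IHk] i j /=; first by rewrite mulg1 addn0.
rewrite mulgA addnS; apply: leq_trans (length_mul _ _ _) _; first by rewrite groupM ?mem_alt.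
by rewrite ltnS.
Qed.

Lemma order_mulC (x y : gT) : #[x * y] = #[y * x].
Proof. by rewrite -(orderJ (x * y) x) conjgE mulgA mulKg. Qed.

(** Here [v] is the shortest representative of the coset of [w] modulo the dihedral subgroup, and
    lengths add. *)
Definition parabolic_factor w i j := exists v k,
  [/\ v \in W, len v <= len (v * s i), len v <= len (v * s j),
     k <= #[s i * s j] & len w = len v + k /\
     (w = v * alt (s i) (s j) k \/ w = v * alt (s j) (s i) k)].

Lemma parabolic_factorC w i j : parabolic_factor w i j -> parabolic_factor w j i.
Proof.
move=> [v [k [Wv vi vj km [lw wE]]]]; exists v, k; rewrite order_mulC.
by split=> //; split=> //; apply/or_comm.
Qed.

Lemma parabolic_factor_step w i j : w \in W -> len (w * s i) < len w ->
  parabolic_factor (w * s i) i j -> parabolic_factor w i j.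
Proof.
move=> Ww wi [v [k [Wv vi vj km [lk vk]]]].
have lw : len w = len v + k.+1.
  by have := length_mulV w i Ww; rewrite addnS -lk; lia.
have bad : 0 < k -> w <> v * alt (s i) (s j) k * s i.
  move=> k_gt0 wE.
  have : len w <= len v + k.-1 by rewrite wE alt_comm // length_alt.
  lia.
have wE : w = v * alt (s j) (s i) k * s i \/ w = v * alt (s i) (s j) k * s i.
  by case: vk => /(congr1 (mulg^~ (s i))) /=; rewrite mulgK_refl; [right|left].
have {}wE : w = v * alt (s j) (s i) k * s i.
  case: wE => // wE; have [k0|/bad//] := posnP k.
  by rewrite wE k0.
exists v, k.+1; split=> //; last by split=> //; left; rewrite wE -mulgA.
(* At full length the braid relation would let the last [s i] cancel, making [w] too short. *)
rewrite ltn_neqAle km andbT; apply/eqP => kE.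
apply: bad; first by rewrite kE.
by rewrite wE kE alt_braid.
Qed.

(** Strip [s i] or [s j] on the right as long as this shortens the element; what remains is [v]. *)
Lemma parabolic_factorP w i j : w \in W -> parabolic_factor w i j.
Proof.
have [l] := ubnP (len w); elim: l => // l IHl in w *; rewrite ltnS => wl Ww.
have [wi|wi] := leqP (len w) (len (w * s i)); last first.
  apply: parabolic_factor_step => //; apply: IHl (leq_trans wi wl) _.
  by rewrite groupM ?mem_gen_refl.
have [wj|wj] := leqP (len w) (len (w * s j)); last first.
  apply/parabolic_factorC/parabolic_factor_step => //.
  apply/parabolic_factorC/IHl; first exact: leq_trans wj wl.
  by rewrite groupM ?mem_gen_refl.
by exists w, 0; split=> //; split; [rewrite addn0|left; rewrite mulg1].
Qed.

End Length.

(** * The geometric representation *)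

Section GeometricRepresentation.
Context (R : realType) {gT : finGroupType} (W : {group gT}) (n : nat) (s : 'I_n -> gT).
Context (rho : gT -> 'M[R]_n).
Hypothesis s_inj : injective s.
Hypothesis s2 : forall i, (s i ^+ 2 = 1)%g.
Hypothesis s1 : forall i, s i != 1%g.
Hypothesis defW : W :=: <<[set s i | i : 'I_n]>>%g.
Hypothesis rhoP : geometric_rep W s rho.

Local Notation m i j := #[(s i * s j)%g]%g.
Local Notation B := (coxB R s).

Let s_in_W := mem_gen_refl W n s defW.

Lemma coxB_diag i : B i i = 1.
Proof. by rewrite /coxB -expg2 s2 order1 divr1 cospi opprK. Qed.

Lemma coxB_sym i j : B i j = B j i.
Proof. by rewrite /coxB order_mulC. Qed.

Lemma mul_coxsigma p (M : 'M[R]_(p, n)) i k j :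
  (M *m coxsigma R s i) k j = M k j - 2 * B i j * M k i.
Proof.
rewrite mxE; under eq_bigr do rewrite mxE mulrBr.
rewrite sumrB; congr (_ - _).
  by rewrite (bigD1 j) //= eqxx mulr1 big1 ?addr0 // => l /negPf->; rewrite mulr0.
rewrite (bigD1 i) //= eqxx big1 ?addr0; last by move=> l /negPf->; rewrite mulr0 mul0r mulr0.
by rewrite mulr1 mulrC.
Qed.

Lemma rho_mul_refl w i k j : w \in W ->
  rho (w * s i)%g k j = rho w k j - 2 * B i j * rho w k i.
Proof. by case: rhoP => rs rM Ww; rewrite rM // rs mul_coxsigma. Qed.

Lemma rho_mul_refl_diag w i k : w \in W -> rho (w * s i)%g k i = - rho w k i.
Proof. by move=> Ww; rewrite rho_mul_refl // coxB_diag; ring. Qed.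

Lemma coxsigma_involutive i : coxsigma R s i *m coxsigma R s i = 1%:M.
Proof.
apply/matrixP => k j; rewrite mul_coxsigma !mxE coxB_diag.
by case: (k == i); case: (k == j) => /=; ring.
Qed.

Lemma rho1 : rho 1%g = 1%:M.
Proof.
case: rhoP => rs rM; apply/matrixP => k j.
by rewrite -(s2 k) expg2 rM // rs coxsigma_involutive.
Qed.

(** [rho w] is invertible. Hence no root is both positive and negative. *)
Lemma rho_col_neq0 w j : w \in W -> exists k, rho w k j != 0.
Proof.
move=> Ww; apply/existsP; apply: contraT => /existsPn w0.
have := rho1; rewrite -(mulVg w); case: rhoP => _ ->; rewrite ?groupV //.
move/matrixP/(_ j j); rewrite !mxE eqxx big1; first by move/eqP; rewrite eq_sym oner_eq0.
by move=> k _; have := w0 k; rewrite negbK => /eqP->; rewrite mulr0.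
Qed.

(* In the plane of [alpha_i] and [alpha_j] the two reflections generate rotations
   by multiples of [2 theta], whence the sines; the parity of [k] tells which of
   the two roots carries which coefficient. *)
Lemma rho_alt v i j k l : v \in W ->
  let theta := pi / (m i j)%:R in
  let x := rho v l (if odd k then j else i) in
  let y := rho v l (if odd k then i else j) in
  sin theta * rho (v * alt (s j) (s i) k)%g l i =
  sin (k.+1%:R * theta) * x + sin (k%:R * theta) * y.
Proof.
move=> Wv /=; set theta := pi / _; have thetaE : cos theta = - B i j by rewrite /coxB opprK.
move: theta thetaE => theta.
(* The sines obey a recurrence of order two, so the induction carries two consecutive [k], for both
   orders of [i] and [j]. *)
suff: forall i j, cos theta = - B i j ->
    (sin theta * rho (v * alt (s j) (s i) k)%g l i =
      sin (k.+1%:R * theta) * rho v l (if odd k then j else i) +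
      sin (k%:R * theta) * rho v l (if odd k then i else j)) /\
    (sin theta * rho (v * alt (s j) (s i) k.+1)%g l i =
      sin (k.+2%:R * theta) * rho v l (if odd k then i else j) +
      sin (k.+1%:R * theta) * rho v l (if odd k then j else i)).
  by move=> /[apply] -[].
have sinS p : sin (p.+2%:R * theta) =
    2 * cos theta * sin (p.+1%:R * theta) - sin (p%:R * theta).
  have -> : p.+2%:R * theta = p.+1%:R * theta + theta by rewrite -[p.+2%:R]natr1 mulrDl mul1r.
  have -> : p%:R * theta = p.+1%:R * theta - theta.
    by rewrite -[p.+1%:R]natr1 mulrDl mul1r addrK.
  by rewrite sinD sinB; ring.
elim: k => [|k IHk] {}i {}j thetaE.
  rewrite sinS /= !mulg1 mul1g mul1r mul0r sin0 rho_mul_refl // -[B j i]opprK coxB_sym -thetaE.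
  by split; ring.
have [IH1 IH2] := IHk i j thetaE; split.
  by rewrite IH2 /=; case: (odd k).
have thetaE' : cos theta = - B j i by rewrite coxB_sym.
have [_ IH2'] := IHk j i thetaE'.
have -> : alt (s j) (s i) k.+2 = (alt (s i) (s j) k.+1 * s j)%g by [].
rewrite mulgA rho_mul_refl ?groupM ?mem_alt //.
have -> : rho (v * alt (s i) (s j) k.+1)%g l i = - rho (v * alt (s j) (s i) k)%g l i.
  by rewrite /= mulgA rho_mul_refl_diag // groupM ?mem_alt.
rewrite mulrBr mulrN IH1 -[B j i]opprK -thetaE'.
rewrite mulrCA IH2' (sinS k.+1) (sinS k) /=; case: (odd k) => /=; ring.
Qed.

Lemma m_ge2 i j : i != j -> (2 <= m i j)%N.
Proof.
move=> ij; rewrite ltn_neqAle order_gt0 andbT eq_sym order_eq1.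
apply: contraNneq ij => sij1; apply/eqP/s_inj/(mulIg (s j)).
by rewrite sij1 -expg2 s2.
Qed.

(** For [k] below [m i j], the angles k theta and (k + 1) theta stay in [0, pi], so both sines in
    [rho_alt] are nonnegative. *)
Lemma rho_alt_ge0 v i j k l : v \in W -> i != j -> (k < m i j)%N ->
  0 <= rho v l i -> 0 <= rho v l j -> 0 <= rho (v * alt (s j) (s i) k)%g l i.
Proof.
move=> Wv ij km vi vj.
have m0 : 0 < (m i j)%:R :> R by rewrite ltr0n order_gt0.
have s0 : 0 < sin (pi / (m i j)%:R) :> R.
  apply: sin_gt0_pi; rewrite divr_gt0 ?pi_gt0 //= ltr_pdivrMr //.
  by rewrite ltr_pMr ?pi_gt0 // ltr1n m_ge2.
have sk p : (p <= m i j)%N -> 0 <= sin (p%:R * (pi / (m i j)%:R)) :> R.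
  move=> pm; apply: sin_ge0_pi; rewrite mulr_ge0 ?divr_ge0 ?pi_ge0 ?ler0n //=.
  by rewrite mulrCA ler_piMr ?pi_ge0 // ler_pdivrMr // mul1r ler_nat.
rewrite -(pmulr_rge0 _ s0) rho_alt // addr_ge0 // mulr_ge0 ?sk //; last by case: odd.
- by case: odd.
- exact: ltnW.
Qed.

(** * The invariant inner product and positivity of the Tits form *)

Hypothesis s_irr : coxeter_irreducible s.

Local Notation sigma := (coxsigma R s).

Definition inv_form : 'M[R]_n := \sum_(w in W) (rho w)^T *m rho w.

Lemma inv_form_sym : inv_form^T = inv_form.
Proof.
rewrite /inv_form raddf_sum; apply: eq_bigr => w _.
by rewrite /= trmx_mul trmxK.
Qed.

Lemma inv_form_invariant i : (sigma i)^T *m inv_form *m sigma i = inv_form.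
Proof.
rewrite mulmx_sumr mulmx_suml [RHS](reindex_inj (mulIg (s i))) /=.
apply: eq_big => [w|w Ww]; first by rewrite groupMr.
by case: rhoP => rs rM; rewrite rM // rs trmx_mul !mulmxA.
Qed.

(** Invariance under the involution [sigma i] makes [inv_form *m sigma i] symmetric; compare its
    entries (k, i) and (i, k). *)
Lemma inv_form_coxB k i : inv_form k i = B i k * inv_form i i.
Proof.
have Asym : inv_form *m sigma i = (inv_form *m sigma i)^T.
  rewrite trmx_mul inv_form_sym -[in RHS](inv_form_invariant i).
  by rewrite !mulmxA -trmx_mul coxsigma_involutive trmx1 mul1mx.
have : (inv_form *m sigma i) k i = (inv_form *m sigma i) i k by rewrite {1}Asym mxE.
rewrite !mul_coxsigma coxB_diag.
have -> : inv_form i k = inv_form k i by rewrite -[in LHS]inv_form_sym mxE.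
lra.
Qed.

Lemma inv_form_gt0 (v : 'cV[R]_n) i : v i 0 != 0 -> 0 < (v^T *m inv_form *m v) 0 0.
Proof.
move=> vi; rewrite mulmx_sumr mulmx_suml summxE (bigD1 1%g) //=.
have sq w : (v^T *m ((rho w)^T *m rho w) *m v) 0 0 = \sum_k ((rho w *m v) k 0) ^+ 2.
  rewrite !mulmxA -mulmxA -trmx_mul mxE; apply: eq_bigr => k _.
  by rewrite mxE expr2.
apply: ltr_pwDl.
  rewrite sq rho1 mul1mx (bigD1 i) //= ltr_pwDl ?exprn_even_gt0 ?vi ?orbT //.
  by apply: sumr_ge0 => k _; rewrite sqr_ge0.
by apply: sumr_ge0 => w _; rewrite sq sumr_ge0 // => k _; rewrite sqr_ge0.
Qed.

Lemma cox_form_gt0 (y : 'I_n -> R) : (exists i, y i != 0) ->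
  0 < cox_form R n (fun i j => m i j) y.
Proof.
move=> [i0 yi0].
have diag_gt0 i : 0 < inv_form i i.
  have := inv_form_gt0 (delta_mx i 0) i.
  by rewrite trmx_delta -rowE -colE !mxE !eqxx oner_neq0 => /(_ isT).
have diag_eq i : inv_form i i = inv_form i0 i0.
  (* No edge leaves [A]: if [B k l] is nonzero, symmetry of [inv_form] forces equal diagonal entries
     at [k] and [l]. *)
  pose A := [set k | inv_form k k == inv_form i0 i0].
  have [] : A = finset.set0 \/ A = [set: 'I_n].
  - apply: s_irr => k l; rewrite !inE => /eqP kA lA.
    have kl : k != l by apply: contraNneq lA => <-; apply/eqP.
    apply: commute_order2 => //; apply/eqP; rewrite eqn_leq m_ge2 // andbT leqNgt.
    apply: contra lA => /(cos_pi_div2_gt0 R) cos_gt0; rewrite -kA.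
    have B_neq0 : B k l != 0 by rewrite oppr_eq0 gt_eqF.
    apply/eqP/(mulfI B_neq0); rewrite -(inv_form_coxB l k) coxB_sym -(inv_form_coxB k l).
    by rewrite -[in LHS]inv_form_sym mxE.
  - by move/setP/(_ i0); rewrite !inE eqxx.
  - by move/setP/(_ i); rewrite !inE => /eqP.
have := inv_form_gt0 (\col_i y i) i0; rewrite mxE => /(_ yi0).
suff -> : ((\col_i y i)^T *m inv_form *m \col_i y i) 0 0 =
    inv_form i0 i0 * cox_form R n (fun i j => m i j) y by rewrite pmulr_rgt0.
rewrite mxE /cox_form mulr_sumr; apply: eq_bigr => j _.
rewrite !mxE mulr_sumr mulr_suml; apply: eq_bigr => i _.
rewrite !mxE (inv_form_coxB i j) (diag_eq j); rewrite /coxB; ring.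
Qed.

(** * Tits' theorem and the counting of descents *)

Variable len : gT -> nat.
Hypothesis lenP : length_like W n s len.

Local Notation factorP := (parabolic_factorP W n s s2 defW len lenP).
Local Notation len_alt := (length_alt W n s defW len lenP).

(** Let [s j] shorten [w], and factor [w] through its shortest coset representative [v]. By
    induction columns [i] and [j] of [v] are nonnegative. As [s i] does not shorten [w], the
    dihedral factor ends in [s j] and is not the longest, so [rho_alt_ge0] applies. *)
Lemma rho_col_ge0 w i k : w \in W -> (len w <= len (w * s i)%g)%N -> 0 <= rho w k i.
Proof.
have [l] := ubnP (len w); elim: l => // l IHl in w i *; rewrite ltnS => wl Ww wi.
have [len0 _ lenS] := lenP.
have [/len0->//|w_gt0] := posnP (len w).
  by rewrite rho1 mxE ler0n.
have [j wj] := lenS w Ww w_gt0.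
have ij : i != j by apply: contraTneq wj => <-; rewrite -leqNgt.
have [v [p [Wv vi vj pm [lw wE]]]] := factorP w i j Ww.
have p_gt0 : (0 < p)%N.
  rewrite lt0n; apply: contraTneq wj => p0.
  have -> : w = v by case: wE => ->; rewrite p0 /= mulg1.
  by rewrite -leqNgt.
have wEj : w = (v * alt (s j) (s i) p)%g.
  case: wE => // wE; suff : (len (w * s i)%g <= len v + p.-1)%N by lia.
  by rewrite wE alt_comm // len_alt.
have pm' : (p < m i j)%N.
  rewrite ltn_neqAle pm andbT; apply/eqP => pE.
  suff : (len (w * s i)%g <= len v + p.-1)%N by lia.
  by rewrite wEj pE -alt_braid // alt_comm ?order_gt0 // len_alt.
by rewrite wEj rho_alt_ge0 // IHl //; lia.
Qed.

Lemma rho_col_le0 w i k : w \in W -> (len (w * s i)%g <= len w)%N -> rho w k i <= 0.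
Proof.
move=> Ww wi; rewrite -oppr_ge0 -rho_mul_refl_diag //.
by apply: rho_col_ge0; rewrite ?groupM // mulgK_refl.
Qed.

Lemma mem_Des w i : w \in W -> (i \in Des rho w) = (len (w * s i)%g < len w)%N.
Proof.
move=> Ww; rewrite inE; case: ltnP => wi.
  by apply/forallP => k; apply: rho_col_le0 => //; apply: ltnW.
apply/negP => /forallP wn; have [k /eqP[]] := rho_col_neq0 w i Ww.
by apply/le_anti; rewrite wn rho_col_ge0.
Qed.

(** The length must change, since otherwise column [i] would be both nonnegative and nonpositive,
    hence zero. *)
Lemma mem_Des_mul w i : w \in W -> (i \in Des rho (w * s i)%g) = (i \notin Des rho w).
Proof.
move=> Ww; have neq x : x \in W -> len (x * s i)%g != len x.
  move=> Wx; apply/eqP => xi; have [k /eqP[]] := rho_col_neq0 x i Wx.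
  by apply/le_anti; rewrite rho_col_le0 ?rho_col_ge0 ?xi.
rewrite !mem_Des ?groupM // mulgK_refl // -leqNgt ltn_neqAle.
by rewrite eq_sym neq.
Qed.

Lemma sum_mem_Des i : (2 * \sum_(w in W) (i \in Des rho w) = #|W|)%N.
Proof.
rewrite mul2n -addnn [in X in (_ + X)%N](reindex_inj (mulIg (s i))) /=.
under [in X in (_ + X)%N]eq_bigl do rewrite groupMr //.
rewrite -big_split /= -sum1_card; apply: eq_bigr => w Ww.
by rewrite mem_Des_mul //; case: (i \in _).
Qed.

(* [v] is the shortest element of its coset; the only nonzero term comes from the
   longest one. *)
Lemma sum_Des_dihedral v i j : v \in W -> i != j ->
  (len v <= len (v * s i)%g)%N -> (len v <= len (v * s j)%g)%N ->
  (\sum_(u in dihedral (s i) (s j))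
     [&& i \in Des rho (v * u)%g & j \in Des rho (v * u)%g] = 1)%N.
Proof.
move=> Wv ij vi vj; set w0 := alt (s i) (s j) (m i j).
have w0E : w0 = alt (s j) (s i) (m i j) by rewrite /w0 alt_braid.
have ge0 a b k l : (a, b) = (i, j) \/ (a, b) = (j, i) -> (k < m i j)%N ->
    0 <= rho (v * alt (s a) (s b) k)%g l b.
  case=> -[-> ->] km; last by apply: rho_alt_ge0; rewrite // rho_col_ge0.
  apply: rho_alt_ge0; rewrite ?rho_col_ge0 //; first by rewrite eq_sym.
  by rewrite order_mulC.
have w0_in : w0 \in dihedral (s i) (s j).
  have [si sj] := dihedral_gen (s i) (s j).
  exact: mem_alt_group.
have notDes a b k : (a, b) = (i, j) \/ (a, b) = (j, i) -> (k < m i j)%N ->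
    b \notin Des rho (v * alt (s a) (s b) k)%g.
  move=> ab km; rewrite inE; apply/negP => /forallP wn.
  have Wk : (v * alt (s a) (s b) k)%g \in W by rewrite groupM ?mem_alt.
  have [l /eqP[]] := rho_col_neq0 _ b Wk.
  by apply/le_anti; rewrite wn ge0.
(* The longest word can be written with last letter [s a]; removing it leaves a shorter word without
   descent [a], and [s a] toggles that descent. *)
have w0_Des a b : (a, b) = (i, j) \/ (a, b) = (j, i) -> a \in Des rho (v * w0)%g.
  move=> ab; have -> : w0 = alt (s a) (s b) (m i j) by case: ab => -[-> ->].
  have := order_gt0 (s i * s j); case mE : (m i j) => [//|k] _ /=.
  have ba : (b, a) = (i, j) \/ (b, a) = (j, i) by case: ab => -[-> ->]; [right|left].
  by rewrite mulgA mem_Des_mul ?groupM ?mem_alt // notDes // mE.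
rewrite (bigD1 w0) //= (w0_Des i j) ?(w0_Des j i) ?big1 //; [|by right|by left].
move=> u /andP[uG uw0].
have [k km uE] := mem_dihedral (s i) (s j) u (s2 i) (s2 j) uG.
have km' : (k < m i j)%N.
  rewrite ltn_neqAle km andbT; apply: contraNneq uw0 => kE.
  by case: uE => ->; rewrite kE -?w0E.
case: uE => ->.
  by rewrite [X in _ && X](negPf (notDes i j k _ _)) ?andbF //; left.
by rewrite (negPf (notDes j i k _ _)) //; right.
Qed.

(** For distinct [i] and [j], [2 * m i j] is the order of the dihedral subgroup. Summing over all
    translates [w * u] and exchanging the sums, each [w] contributes the count of its coset, which
    is 1. *)
Lemma sum_mem_Des2 i j :
  (2 * m i j * \sum_(w in W) ((i \in Des rho w) && (j \in Des rho w)) = #|W|)%N.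
Proof.
have [->|ij] := eqVneq i j.
  rewrite -expg2 s2 order1 muln1 -(sum_mem_Des j); congr (_ * _)%N.
  by apply: eq_bigr => w _; rewrite andbb.
pose D w : nat := (i \in Des rho w) && (j \in Des rho w).
rewrite -[X in (_ * X)%N]/(\sum_(w in W) D w)%N -card_dihedral // -sum_nat_const.
have GW : dihedral (s i) (s j) \subset W by rewrite /= join_subG !cycle_subG groupM ?s_in_W.
have -> : (\sum_(u in dihedral (s i) (s j)) \sum_(w in W) D w =
    \sum_(u in dihedral (s i) (s j)) \sum_(w in W) D (w * u)%g)%N.
  apply: eq_bigr => u /(fintype.subsetP GW) Wu; rewrite (reindex_inj (mulIg u)) /=.
  by apply: eq_bigl => w; rewrite groupMr.
rewrite exchange_big /= -sum1_card; apply: eq_bigr => w Ww.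
have [v [p [Wv vi vj _ [_ wE]]]] := factorP w i j Ww.
have [a aG ->] : exists2 a, a \in dihedral (s i) (s j) & w = (v * a)%g.
  have [si sj] := dihedral_gen (s i) (s j).
  by case: wE => ->; [exists (alt (s i) (s j) p)|exists (alt (s j) (s i) p)];
    rewrite ?mem_alt_group.
rewrite -[RHS](sum_Des_dihedral v i j) // [RHS](reindex_inj (mulgI a)) /=.
by apply: eq_big => [u|u _]; rewrite ?mulgA // groupMl.
Qed.

(** * Mean and variance *)

Lemma desE w : des rho w = (\sum_i (i \in Des rho w))%N.
Proof. by rewrite /des -sum1_card big_mkcond. Qed.

Let cardW_neq0 : #|W|%:R != 0 :> R.
Proof. by rewrite pnatr_eq0 -lt0n cardG_gt0. Qed.

Lemma mean_des : unif_mean R W (des rho) = n%:R / 2.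
Proof.
rewrite /unif_mean -natr_sum; under eq_bigr do rewrite desE.
rewrite exchange_big /= natr_sum mulr_suml (eq_bigr (fun=> 2^-1)).
  by rewrite sumr_const card_ord mulr_natl.
move=> i _; rewrite -(sum_mem_Des i) natrM; have := cardW_neq0.
rewrite -{1}(sum_mem_Des i) natrM mulf_eq0 => /norP[_ D0]; field.
exact: D0.
Qed.

Lemma var_des : unif_var R W (des rho) = (\sum_i \sum_j (m i j)%:R^-1) / 2 - (n%:R / 2) ^+ 2.
Proof.
rewrite /unif_var mean_des; set mu := n%:R / 2.
have -> : (\sum_i \sum_j (m i j)%:R^-1) / 2 =
    (\sum_(w in W) (des rho w)%:R ^+ 2) / #|W|%:R :> R.
  rewrite (eq_bigr (fun w => \sum_i \sum_j
    ((i \in Des rho w) && (j \in Des rho w))%:R)); last first.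
    move=> w _; rewrite desE natr_sum expr2 big_distrlr /=.
    by apply: eq_bigr => i _; apply: eq_bigr => j _; rewrite -natrM mulnb.
  rewrite [in RHS]exchange_big /= !mulr_suml; apply: eq_bigr => i _.
  rewrite [in RHS]exchange_big /= !mulr_suml; apply: eq_bigr => j _.
  rewrite -natr_sum -(sum_mem_Des2 i j) !natrM; have := cardW_neq0.
  rewrite -{1}(sum_mem_Des2 i j) !natrM !mulf_eq0 !negb_or => /andP[/andP[_ m0] D0].
  by field; rewrite D0 m0.
have : (\sum_(w in W) (des rho w)%:R) / #|W|%:R = mu := mean_des.
move/(canRL (divfK cardW_neq0)) => sum_des.
under eq_bigr do rewrite sqrrB -mulrnAr.
rewrite big_split /= sumrB sumr_const -mulr_suml sum_des.
by rewrite -[_ *+ #|W|]mulr_natr; field.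
Qed.

Lemma sum_inv_order : (2 <= n)%N ->
  \sum_i \sum_j (m i j)%:R^-1 = tree_inv_sum R n%:R (coxeter_max_m s)%:R.
Proof.
move=> n2; pose M i j := m i j.
have M_irr (A : {set 'I_n}) : (forall i j, i \in A -> j \notin A -> M i j = 2%N) ->
    A = finset.set0 \/ A = [set: 'I_n].
  by move=> hA; apply: s_irr => i j iA jA; apply: commute_order2 => //; apply: hA.
have M_diag i : M i i = 1%N by rewrite /M -expg2 s2 order1.
have M_sym i j : M i j = M j i by apply: order_mulC.
have M_le i j : (M i j <= coxeter_max_m s)%N.
  by apply: leq_trans (bigop.leq_bigmax i); apply: (bigop.leq_bigmax j).
have In_gt0 : (0 < #|'I_n|)%N by rewrite card_ord ltnW.
have [a maxa] := bigop.eq_bigmax (fun i => \max_(j < n) M i j) In_gt0.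
have [b maxb] := bigop.eq_bigmax (M a) In_gt0.
have maxE : coxeter_max_m s = M a b by rewrite -maxb -maxa.
have ab : a != b.
  pose i0 : 'I_n := Ordinal (ltnW n2); pose i1 : 'I_n := Ordinal n2.
  have := leq_trans (m_ge2 i0 i1 isT) (M_le i0 i1).
  by apply: contraTneq => ab; rewrite maxE -ab M_diag.
(* If all labels were at most 2, the singleton of [a] would contradict irreducibility. *)
have Mab3 : (3 <= M a b)%N.
  rewrite ltnNge; apply/negP => Mab.
  have [i j ia ja|/setP/(_ a)|/setP/(_ b)] := M_irr (finset.set1 a).
  - have ij : i != j by apply: contraNneq ja => <-.
    apply/eqP; rewrite eqn_leq [(1 < _)%N]m_ge2 // andbT.
    by apply: leq_trans (M_le i j) _; rewrite maxE.
  - by rewrite !inE eqxx.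
  - by rewrite !inE eq_sym (negPf ab).
have tree c := inv_sumT R n M M_diag M_sym m_ge2 M_irr (cox_form_gt0) c.
have -> : \sum_i \sum_j (m i j)%:R^-1 = inv_sum R n M [set: 'I_n].
  rewrite /inv_sum; apply: eq_big => [i|i _]; first by rewrite !inE.
  by apply: eq_bigl => j; rewrite !inE.
rewrite maxE; have cos4 := cos_pi_div4_sqr R; have cos4_gt0 := cos_pi_div2_gt0 R 4 isT.
(* For a maximal label at least 4 take [c] = cos(pi / 4), where 2 c^2 = 1; for label 3 take [c] = 1,
   where 2 cos(pi / 3) = 1 and no label reaches 4. *)
have [Mab4|Mab4] := leqP 4 (M a b).
  apply: (tree (cos (pi / 4))) => // [|i j Mij|].
  - exact: cos_le1.
  - exact: cos_pi_div_le.
  - have : cos (pi / 4) <= cos (pi / (M a b)%:R) :> R by apply: cos_pi_div_le.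
    nra.
apply: (tree 1) => // [i j Mij|].
  by have := leq_trans Mij (M_le i j); rewrite maxE leqNgt Mab4.
have -> : M a b = 3%N by apply/eqP; rewrite eqn_leq -ltnS Mab4.
by rewrite cos_pi_div3; lra.
Qed.

End GeometricRepresentation.

Theorem theorem4p1 (R : realType) (gT : finGroupType) (W : {group gT}) (n : nat)
    (s : 'I_n -> gT) (rho : gT -> 'M[R]_n) :
  (2 <= n)%N ->
  coxeter_system W s ->
  coxeter_irreducible s ->
  geometric_rep W s rho ->
  unif_mean R W (des rho) = n%:R / 2 /\
  unif_var R W (des rho) = (n%:R - 2) / 12 + 1 / (coxeter_max_m s)%:R.
Proof.
move=> n2 [s_inj s12 defW _] s_irr rhoP.
have s1 i : s i != 1%g by case: (s12 i).
have s2 i : (s i ^+ 2 = 1)%g by case: (s12 i).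
have [len lenP] := length_like_exists W n s s2 defW.
split; first exact: (mean_des R W n s rho s_inj s2 defW rhoP len lenP).
rewrite (var_des R W n s rho s_inj s2 s1 defW rhoP len lenP).
(* Half of the sum is n^2 / 4 + (n - 2) / 12 + 1 / m, and the squared mean cancels n^2 / 4. *)
rewrite (sum_inv_order R W n s rho s_inj s2 defW rhoP s_irr n2) /tree_inv_sum.
rewrite mul1r; move: (coxeter_max_m s)%:R^-1 => x; by field.
Qed.
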